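(* Consider the Lyness recurrences $x_{n+2}=\dfrac{a+x_{n+1}}{x_n}$ with $a\in\mathbb{C}$. The only globally periodic ones are the case $a=1$, which is globally $5$-periodic, and the case $a=0$, which is globally $6$-periodic.
   Context: A recurrence is globally $p$-periodic if for all (complex) initial conditions for which the sequence $\{x_n\}$ is well defined, the sequence is $p$-periodic ($x_{n+p}=x_n$ for all $n$), and $p$ is the smallest positive integer with this property. It is globally periodic if it is globally $p$-periodic for some $p$. *)

(* Defs.v *)
From HB Require Import structures.
From mathcomp Require Import all_boot all_order all_algebra.
From mathcomp Require Import reals.
From mathcomp.real_closed Require Import complex.

Set Implicit Arguments.
Unset Strict Implicit.
Unset Printing Implicit Defensive.

Import Order.TTheory GRing.Theory Num.Theory.

Local Open Scope ring_scope.

(* A second-order recurrence x_(n+2) = f (x_n, x_(n+1)) is given by a partial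
   map f, with value None where the right-hand side is undefined.  Since a
   solution is determined by (x_0, x_1), the initial conditions for which the
   sequence is well defined are exactly the pairs (x 0, x 1) for x a solution. *)
Definition recurrence (T : Type) : Type := T -> T -> option T.

Definition solution (T : Type) (f : recurrence T) (x : nat -> T) : Prop :=
  forall n : nat, f (x n) (x n.+1) = Some (x n.+2).

Definition periodic (T : Type) (p : nat) (x : nat -> T) : Prop :=
  forall n : nat, x (n + p)%N = x n.

(* Minimality of p concerns all solutions simultaneously: particular solutions
   (constant ones, for instance) may have a smaller period. *)
Definition globally_periodic_of (T : Type) (f : recurrence T) (p : nat) : Prop :=
  [/\ (0 < p)%N,
      forall x : nat -> T, solution f x -> periodic p x &
      forall q : nat, (0 < q)%N ->
        (forall x : nat -> T, solution f x -> periodic q x) -> (p <= q)%N].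

Definition globally_periodic (T : Type) (f : recurrence T) : Prop :=
  exists p : nat, globally_periodic_of f p.

Definition lyness (F : fieldType) (a : F) : recurrence F :=
  fun u v => if u == 0 then None else Some ((a + v) / u).

(* Main.v *)
(* Suppose that a is not 0 and that all solutions are p-periodic.  Let z be a
   fixed point, z^2 = a + z, and let lam be an eigenvalue of the linearization at
   z, so that z (1 + lam^2) = lam.  The orbit of (z + t, z + lam t) consists of
   rational functions of t with n-th term z + lam^n t + O(t^2); C being
   uncountable, for some t none of their numerators and denominators vanishes, and
   p-periodicity at such t forces lam^p = 1.  Hence |lam| = 1, so that
   1 / z = lam + 1 / lam is real, and a = z^2 - z is real.  For real a, the third
   iterate acts on the invariant line x = -1 by a Moebius map with multiplier
   a - 1, which has finite order only if a - 1 = -1, and which is parabolic if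
   a = 2; an imaginary starting parameter keeps the orbit away from the poles. *)
Require Import Defs.
From HB Require Import structures.
From mathcomp Require Import all_boot all_order all_algebra.
From mathcomp Require Import reals.
From mathcomp.real_closed Require Import complex.
From mathcomp Require Import boolp classical_sets cardinality ereal measure.
From mathcomp Require Import lebesgue_measure ring.

Set Implicit Arguments.
Unset Strict Implicit.
Unset Printing Implicit Defensive.

Import Order.TTheory GRing.Theory Num.Theory.

Local Open Scope ring_scope.

(** Each [f n] has finitely many roots, so the real numbers that are roots of some [f n] form a
    countable, hence Lebesgue-null, set. *)
Lemma exists_common_nonroot (R : realType) (f : nat -> {poly R[i]}) :
  (forall n, f n != 0) -> exists t, forall n, (f n).[t] != 0.
Proof.
move=> f0; apply: contrapT => noroot.
pose A n := [set r : R | root (f n) r%:C%C]%classic.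
have cA : countable (\bigcup_n A n)%classic.
  apply: bigcup_countable => // n _; apply: finite_set_countable.
  have [s fE] := closed_field_poly_normal (f n).
  apply: (@sub_finite_set _ _ [set` map (@complex.Re R) s]%classic); last first.
    exact: finite_seq.
  move=> r /=; rewrite /A /= fE rootZ ?lead_coef_eq0 // root_prod_XsubC => rs.
  by apply/mapP; exists r%:C%C.
suff : (\bigcup_n A n)%classic = setT :> set R.
  move=> AT; have := countable_lebesgue_measure0 cA.
  rewrite AT => T0.
  have : (lebesgue_measure (`]0%R, 1%R[%classic : set R) <= 0)%E.
    by rewrite -T0; apply: le_measure; rewrite ?inE.
  by rewrite lebesgue_measure_itv /= lte01 oppr0 adde0 leNgt lte01.
apply/seteqP; split=> // r _; apply: contrapT => rA; apply: noroot.
by exists r%:C%C => n; apply/negP => rn; apply: rA; exists n.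
Qed.

Lemma periodic_mul (T : Type) (p q : nat) (x : nat -> T) :
  periodic p x -> periodic (q * p) x.
Proof.
move=> xp; elim: q => [|q IHq] n; first by rewrite addn0.
by rewrite mulSn addnA IHq xp.
Qed.

Lemma solution_lynessE (F : fieldType) (a : F) (x : nat -> F) :
  solution (lyness a) x <->
  (forall n, x n != 0) /\ (forall n, x n.+2 * x n = a + x n.+1).
Proof.
split=> [xP|[x0 xP] n]; last first.
  by rewrite /lyness (negbTE (x0 n)) -xP mulfK.
have x0 n : x n != 0 by have := xP n; rewrite /lyness; case: ifP.
split=> // n; have := xP n; rewrite /lyness (negbTE (x0 n)) => -[<-].
by rewrite divfK.
Qed.

(** * The two periodic parameters *)

Lemma lyness1_periodic (F : fieldType) (x : nat -> F) :
  solution (lyness 1) x -> periodic 5 x.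
Proof.
move=> /solution_lynessE [x0 xP] n.
rewrite addnC !addSn add0n.
(* Both sides get expressed through [x n.+1] and [x n.+2]: the only denominators are then these two
   and [1 + x n.+2]. *)
have E0 : x n = (1 + x n.+1) / x n.+2 by rewrite -xP mulrC mulKf.
have E k : x k.+2 = (1 + x k.+1) / x k by rewrite -xP mulfK.
have n1 : 1 + x n.+2 != 0 by rewrite -xP mulf_neq0.
have [? ?] := (x0 n.+1, x0 n.+2).
rewrite E0 (E n.+3) (E n.+2) (E n.+1).
by field; do ?[apply/andP; split].
Qed.

Lemma lyness0_periodic (F : fieldType) (x : nat -> F) :
  solution (lyness 0) x -> periodic 6 x.
Proof.
move=> /solution_lynessE [x0 xP] n.
rewrite addnC !addSn add0n.
have E k : x k.+2 = x k.+1 / x k by rewrite -[x k.+1]add0r -xP mulfK.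
have [? ?] := (x0 n, x0 n.+1); rewrite !E.
by field; rewrite !x0 oner_neq0.
Qed.

Lemma solution_cycle (F : fieldType) (a : F) (s : seq F) : (0 < size s)%N ->
  all (predC1 0) s ->
  all (fun i => s`_(i.+2 %% size s) * s`_i == a + s`_(i.+1 %% size s))
    (iota 0 (size s)) ->
  solution (lyness a) (fun n => s`_(n %% size s)).
Proof.
move=> s_gt0 /allP s0 /allP sP.
apply/solution_lynessE; split=> n; first by apply/s0/mem_nth; rewrite ltn_pmod.
have := sP (n %% size s)%N; rewrite mem_iota /= add0n ltn_pmod // => /(_ isT)/eqP.
by rewrite -[(_ %% _)%N.+2]addn2 -[(_ %% _)%N.+1]addn1 !modnDml addn2 addn1.
Qed.

Lemma lyness1_min_period (F : numFieldType) (q : nat) : (0 < q)%N ->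
  (forall x : nat -> F, solution (lyness 1) x -> periodic q x) -> (5 <= q)%N.
Proof.
move=> q_gt0 qP; rewrite leqNgt; apply/negP => q_lt5.
(* The orbit of (1, 1): this pair does not recur before index 5, so indices 0 and 1 exclude every
   smaller [q]. *)
have /qP xq : solution (lyness (1 : F))
    (fun n => [:: 1; 1; 2; 3; 2]`_(n %% 5)).
  apply: (@solution_cycle _ _ [:: 1; 1; 2; 3; 2]) => //=.
    by rewrite oner_eq0 !pnatr_eq0.
  by rewrite !mulr1 ?mul1r -!natrM -?natrD -?[1 + _]natrD !eqxx.
have := xq 1; have := xq 0.
by case: q q_gt0 q_lt5 {qP xq} => [|[|[|[|[|]]]]] //= _ _ /eqP + /eqP;
  rewrite pnatr_eq1.
Qed.

Lemma lyness0_min_period (F : numFieldType) (q : nat) : (0 < q)%N ->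
  (forall x : nat -> F, solution (lyness 0) x -> periodic q x) -> (6 <= q)%N.
Proof.
move=> q_gt0 qP; rewrite leqNgt; apply/negP => q_lt6.
have /qP xq : solution (lyness (0 : F))
    (fun n => [:: 1; 2; 2; 1; 2^-1; 2^-1]`_(n %% 6)).
  apply: (@solution_cycle _ _ [:: 1; 2; 2; 1; 2^-1; 2^-1]) => //=.
    by rewrite oner_eq0 !invr_eq0 !pnatr_eq0.
  by rewrite !(mulr1, mul1r, add0r) !(mulVf, mulfV) ?pnatr_eq0 // !eqxx.
(* Needed for [q = 3], where the terms at index 0 agree and those at index 1 are 2 and [2^-1]. *)
have half_neq2 : (2^-1 == 2 :> F) = false.
  rewrite -(inj_eq (mulfI (_ : 2 != 0))) ?pnatr_eq0 // mulfV ?pnatr_eq0 //.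
  by rewrite -natrM eq_sym pnatr_eq1.
have := xq 1; have := xq 0.
by case: q q_gt0 q_lt6 {qP xq} => [|[|[|[|[|[|]]]]]] //= _ _ /eqP + /eqP;
  rewrite ?invr_eq1 ?half_neq2 ?pnatr_eq1.
Qed.

(** * Perturbation of a fixed point *)

Section HomogeneousOrbit.

Variables (A : comNzRingType) (a : A).

(* A pair [(u, d)] stands for the fraction [u / d]. *)
Definition lyness_frac_step (s : (A * A) * (A * A)) : (A * A) * (A * A) :=
  (s.2, ((a * s.2.2 + s.2.1) * s.1.2, s.2.2 * s.1.1)).

(** Nothing is divided or cancelled, so the orbit makes sense over polynomials and can be evaluated
    afterwards. *)
Definition lyness_frac (u v : A) (n : nat) : A * A :=
  (iter n lyness_frac_step ((u, 1), (v, 1))).1.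

Lemma lyness_fracS u v n : lyness_frac u v n.+2 =
  ((a * (lyness_frac u v n.+1).2 + (lyness_frac u v n.+1).1) *
     (lyness_frac u v n).2,
   (lyness_frac u v n.+1).2 * (lyness_frac u v n).1).
Proof. by []. Qed.

End HomogeneousOrbit.

Section FixedPoint.

Variables (F : fieldType) (a z lam : F).
Hypotheses (z0 : z != 0) (zE : z ^+ 2 = a + z).
Hypothesis lamE : z * (1 + lam ^+ 2) = lam.

Let orb := lyness_frac a%:P (z%:P + 'X) (z%:P + lam *: 'X).

Lemma lyness_frac_tangent n : exists e,
  (orb n).1 = (orb n).2 * (z%:P + lam ^+ n *: 'X) + 'X^2 * e.
Proof.
suff [] : (exists e,
    (orb n).1 = (orb n).2 * (z%:P + lam ^+ n *: 'X) + 'X^2 * e) /\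
  (exists e, (orb n.+1).1 =
    (orb n.+1).2 * (z%:P + lam ^+ n.+1 *: 'X) + 'X^2 * e) by [].
elim: n => [|n [[e IH0] [f IH1]]].
  split; exists 0; rewrite /orb /lyness_frac /= mul1r mulr0 addr0 //.
  by rewrite expr0 scale1r.
split; first by exists f.
rewrite {}/orb in IH0 IH1 *; rewrite lyness_fracS /= IH1 IH0.
set d := (lyness_frac _ _ _ n).2; set d' := (lyness_frac _ _ _ n.+1).2.
have zE' : z%:P ^+ 2 = a%:P + z%:P :> {poly F} by rewrite -rmorphXn zE rmorphD.
have lamE' : z%:P * (1 + lam%:P ^+ 2) = lam%:P :> {poly F}.
  by rewrite -{2}lamE rmorphM rmorphD rmorphXn.
(* This is the coefficient of ['X^2] in the expansion; the constant term cancels by [zE] and the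
   linear one by [lamE]. *)
exists (f * d - d' * e * (z%:P + lam ^+ n.+2 *: 'X)
        - d' * d * (lam ^+ n * lam ^+ n.+2)%:P).
rewrite -!mul_polyC !exprS !rmorphM /=; set m := (lam ^+ n)%:P.
have -> : a%:P = z%:P ^+ 2 - z%:P by rewrite zE' addrK.
apply/eqP; rewrite -subr_eq0; set D := _ - _.
have -> : D = d * d' * 'X * m * (lam%:P - z%:P * (1 + lam%:P ^+ 2)).
  by rewrite /D; ring.
by rewrite lamE' subrr mulr0.
Qed.

(** At 0 every fraction equals [z], and each new denominator is a product of an earlier denominator
    and numerator. *)
Lemma lyness_frac_neq0 n : (orb n).1.[0] != 0 /\ (orb n).2.[0] != 0.
Proof.
have num0 k : (orb k).1.[0] = (orb k).2.[0] * z.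
  have [e ->] := lyness_frac_tangent k.
  by rewrite !hornerE expr0n mul0r addr0.
suff [d0 _] : (orb n).2.[0] != 0 /\ (orb n.+1).2.[0] != 0 by rewrite num0 mulf_neq0.
elim: n => [|n [IH0 IH1]]; first by rewrite /orb /lyness_frac /= !hornerE oner_eq0.
split=> //; rewrite /orb lyness_fracS hornerM mulf_neq0 //.
by rewrite -/(orb n) num0 mulf_neq0.
Qed.

Lemma lyness_eigenvalue_expr1 (p : nat) :
  (forall f : nat -> {poly F}, (forall n, f n != 0) ->
     exists t, forall n, (f n).[t] != 0) ->
  (forall x : nat -> F, solution (lyness a) x -> periodic p x) -> lam ^+ p = 1.
Proof.
move=> nonroot xp.
have neq0 n : (orb n).1 != 0 /\ (orb n).2 != 0.
  have [h1 h2] := lyness_frac_neq0 n.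
  by split; [apply: contraNneq h1 | apply: contraNneq h2] => ->; rewrite horner0.
pose Q := (orb p).1 - (orb p).2 * (z%:P + 'X).
have Q0 : Q = 0.
  apply/eqP/negP => Q0.
  (* [Q] joins the numerators and denominators in one countable family, so that a single [t] yields
     a true solution with [x p] different from [x 0]. *)
  have [|t tP] := nonroot
      (fun n => if n is k.+1 then (orb k).1 * (orb k).2 else Q).
    by case=> [|k]; [exact/negP | have [? ?] := neq0 k; rewrite mulf_neq0].
  have tN k : (orb k).1.[t] != 0 /\ (orb k).2.[t] != 0.
    by have := tP k.+1; rewrite hornerM mulf_eq0 negb_or => /andP[].
  pose x n := (orb n).1.[t] / (orb n).2.[t].
  have /xp/(_ 0) : solution (lyness a) x.
    apply/solution_lynessE; split=> n; have [n0 d0] := tN n.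
      by rewrite mulf_neq0 ?invr_eq0.
    have [n1 d1] := tN n.+1.
    rewrite /x [orb n.+2]lyness_fracS -/(orb n) -/(orb n.+1).
    move: (orb n) (orb n.+1) n0 d0 n1 d1 => [u d] [v e] /= n0 d0 n1 d1.
    by rewrite !(hornerD, hornerM, hornerC); field; rewrite n0 d0 d1.
  rewrite add0n /x /= !hornerE divr1 => E; have := tP 0.
  by rewrite /= /Q !hornerE -E mulrC divfK ?subrr ?eqxx ?(proj2 (tN p)).
have [e eE] := lyness_frac_tangent p.
(* Cancelling ['X] and evaluating at 0 isolates [lam ^+ p - 1], up to a nonzero denominator. *)
have : ((orb p).2 * (lam ^+ p - 1)%:P + 'X * e) * 'X == 0.
  apply/eqP; rewrite -[RHS]Q0 /Q eE -mul_polyC rmorphB /=; ring.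
rewrite mulf_eq0 polyX_eq0 orbF => /eqP/(congr1 (horner^~ 0)).
rewrite !hornerE; move/eqP.
by rewrite mulf_eq0 (negbTE (proj2 (lyness_frac_neq0 p))) subr_eq0 => /eqP.
Qed.

End FixedPoint.

(** * Real parameters *)

(* The lines [x = -1], [y = -1], [x + y + a = 0] are permuted cyclically, and the
   third iterate acts on [x = -1] by the Moebius map [v |-> (1 - a) / (a + v)]. *)
Lemma lyness_line_solution (F : fieldType) (a : F) (v : nat -> F) : a != 1 ->
  v 0 != 0 -> (forall k, v k.+1 * (a + v k) = 1 - a) ->
  exists2 x, solution (lyness a) x & forall k, x (k * 3).+1 = v k.
Proof.
move=> a1 v0 vP.
(* Consecutive pairs lie in turn on the lines x = -1, x + y + a = 0 and y = -1. *)
pose x n := [:: -1; v (n %/ 3)%N; - a - v (n %/ 3)%N]`_(n %% 3).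
have xE k r : (r < 3)%N -> x (k * 3 + r)%N = [:: -1; v k; - a - v k]`_r.
  by move=> r3; rewrite /x divnMDl // modnMDl !(divn_small, modn_small) ?addn0.
exists x => [|k]; last by rewrite -addn1 xE.
have : 1 - a != 0 by rewrite subr_eq0 eq_sym.
move=> b0; have av k : a + v k != 0.
  by apply: contraNneq b0 => avk; rewrite -(vP k) avk mulr0.
have vn k : v k != 0.
  by case: k => // k; apply: contraNneq b0 => vk; rewrite -(vP k) vk mul0r.
apply/solution_lynessE; split=> n; rewrite (divn_eq n 3);
  set k := (n %/ 3)%N; have : (n %% 3 < 3)%N by rewrite ltn_pmod.
  case: (n %% 3)%N => [|[|[|]]] //= _; rewrite xE //= ?oppr_eq0 ?oner_eq0 //.
  by rewrite -opprD oppr_eq0.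
have x3 : x (k * 3 + 3)%N = -1 by rewrite addnC -mulSn -[(_ * _)%N]addn0 xE.
have x4 : x (k * 3 + 4)%N = v k.+1 by rewrite addnC -(addn1 3) addnAC -mulSn xE.
case: (n %% 3)%N => [|[|[|]]] //= _; rewrite -!addnS.
- by rewrite !xE //=; ring.
- by rewrite x3 !xE //=; ring.
- by rewrite x3 x4 xE //= -opprD mulrN vP; ring.
Qed.

Lemma real_lyness_not_periodic (C : numClosedFieldType) (a : C) (p : nat) :
  a \is Num.real -> a != 0 -> a != 1 -> (0 < p)%N ->
  ~ (forall x : nat -> C, solution (lyness a) x -> periodic p x).
Proof.
move=> aR a0 a1 p_gt0 xp.
(* The line x = -1 is revisited every third step, so the period is first multiplied by 3. *)
have vp (v : nat -> C) : v 0 != 0 ->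
    (forall k, v k.+1 * (a + v k) = 1 - a) -> v p = v 0.
  move=> v0 vP; have [x /xp/(periodic_mul 3) x3p xE] := lyness_line_solution a1 v0 vP.
  by rewrite -!xE -[RHS]x3p mulnC.
have iR (r : C) : r \is Num.real -> 'i != r.
  by move=> rR; apply: contraTneq rR => <-; exact: nonRealCi.
have [a2|a2] := eqVneq a 2.
  have ik k : 'i + k%:R != 0 :> C by rewrite addr_eq0 iR ?rpredN ?realn.
  (* For [a = 2] both fixed points merge at -1, and the coordinate 1 / (v + 1) increases by 1 at
     each step. *)
  pose v k : C := ('i + k%:R)^-1 - 1.
  have v0 : v 0 != 0 by rewrite /v addr0 subr_eq0 invr_eq1 iR ?real1.
  have vP k : v k.+1 * (a + v k) = 1 - a.
    have := (ik k, ik k.+1); rewrite /v a2 -natr1 addrA.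
    by move: ('i + k%:R) => r [? ?]; field; apply/andP.
  move: (vp v v0 vP) => /addIr/invr_inj/eqP.
  by rewrite addr0 -subr_eq0 addrC addKr pnatr_eq0 -leqn0 leqNgt p_gt0.
(* [s = (v + b) / (v + 1)] maps the fixed points [- b] and [-1] to 0 and infinity. *)
pose b := a - 1; pose s k := 'i * b ^+ k.
have b0 : b != 0 by rewrite subr_eq0.
have bR : b \is Num.real by rewrite rpredB ?real1.
have s1 k : 1 - s k != 0.
  have bk0 : b ^+ k != 0 by rewrite expf_neq0.
  have : 'i != (b ^+ k)^-1 by rewrite iR // rpredV rpredX.
  rewrite subr_eq0; apply: contraNneq => sk.
  by rewrite -(inj_eq (mulIf bk0)) mulVf // sk.
pose v k := (s k - b) / (1 - s k).
have v0 : v 0 != 0 by rewrite mulf_neq0 ?invr_eq0 // /s expr0 mulr1 subr_eq0 iR.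
have vP k : v k.+1 * (a + v k) = 1 - a.
  have := s1 k.+1; have -> : a = b + 1 by rewrite subrK.
  have sb : s k.+1 = b * s k by rewrite /s exprS mulrCA.
  by rewrite /v sb => ?; field; apply/andP.
(* [1 - b] is the determinant of the Moebius map from [s] to [v], so [v p = v 0] gives
   [s p = s 0]. *)
have b1 : 1 - b != 0 by rewrite /b opprB addrA subr_eq0 eq_sym.
have /eqP := vp v v0 vP; rewrite eqr_div // -subr_eq0.
have -> : (s p - b) * (1 - s 0) - (s 0 - b) * (1 - s p) = (s p - s 0) * (1 - b) by ring.
rewrite mulf_eq0 (negbTE b1) orbF subr_eq0 /s expr0 (inj_eq (mulfI (neq0Ci C))) => /eqP bp.
(* A real number of modulus 1 is 1 or -1, that is, [a] is 2 or 0. *)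
have : `|b| == 1 by rewrite -(pexpr_eq1 p_gt0) // -normrX bp normr1.
rewrite real_eqr_norml // ler01 andbT => /orP[/eqP bE|/eqP bE].
  by move: b1; rewrite bE subrr eqxx.
by move: a0; rewrite -[a](subrK 1) -/b bE addNr eqxx.
Qed.

(** On the unit circle conjugation is inversion, so [z] is the inverse of the real number
    [lam + lam^*]. *)
Lemma unit_eigenvalue_real (C : numClosedFieldType) (z lam : C) (p : nat) :
  (0 < p)%N -> lam ^+ p = 1 -> z * (1 + lam ^+ 2) = lam -> z \is Num.real.
Proof.
move=> p_gt0 lamp lamE.
have lam1 : `|lam| = 1.
  by apply/eqP; rewrite -(pexpr_eq1 p_gt0) // -normrX lamp normr1.
have lamJ : lam * lam^* = 1 by rewrite -normCK lam1 expr1n.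
have zJ : z * (lam + lam^*) = 1.
  have -> : lam + lam^* = (1 + lam ^+ 2) * lam^*.
    by rewrite mulrDl mul1r expr2 -mulrA lamJ mulr1 addrC.
  by rewrite mulrA lamE.
have s0 : lam + lam^* != 0.
  by apply/eqP => s0; move/eqP: zJ; rewrite s0 mulr0 eq_sym oner_eq0.
rewrite -(mulfK s0 z) zJ div1r.
by rewrite rpredV CrealE rmorphD /= conjCK addrC.
Qed.

Theorem proposition5 (R : realType) :
  [/\ globally_periodic_of (lyness (1 : R[i])) 5,
      globally_periodic_of (lyness (0 : R[i])) 6 &
      forall a : R[i], globally_periodic (lyness a) -> a = 1 \/ a = 0].
Proof.
split.
- by split=> //; [exact: lyness1_periodic | exact: lyness1_min_period].
- by split=> //; [exact: lyness0_periodic | exact: lyness0_min_period].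
move=> a [p [p_gt0 xp _]].
have [->|a0] := eqVneq a 0; first by right.
have [->|a1] := eqVneq a 1; first by left.
pose z := (1 + sqrtC (1 + 4 * a)) / 2.
have zE : z ^+ 2 = a + z.
  have := sqrtCK (1 + 4 * a); rewrite /z; set w := sqrtC _ => wE.
  have -> : a = (w ^+ 2 - 1) / 4 by rewrite wE; field.
  by field.
have z0 : z != 0.
  by apply: contraNneq a0 => z0; rewrite z0 expr0n addr0 in zE; rewrite -zE.
(* A root of z lam^2 - lam + z = 0, by the quadratic formula. *)
pose lam := (1 + sqrtC (1 - 4 * z ^+ 2)) / (2 * z).
have lamE : z * (1 + lam ^+ 2) = lam.
  have := sqrtCK (1 - 4 * z ^+ 2); rewrite /lam; set w := sqrtC _ => wE.
  apply/eqP; rewrite -subr_eq0.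
  have -> : z * (1 + ((1 + w) / (2 * z)) ^+ 2) - (1 + w) / (2 * z) =
      (w ^+ 2 - (1 - 4 * z ^+ 2)) / (4 * z) by field.
  by rewrite wE subrr mul0r.
have lamp := lyness_eigenvalue_expr1 z0 zE lamE (@exists_common_nonroot R) xp.
have zR := unit_eigenvalue_real p_gt0 lamp lamE.
have aR : a \is Num.real by rewrite -(addrK z a) -zE rpredB ?rpredX.
by case: (real_lyness_not_periodic aR a0 a1 p_gt0 xp).
Qed.
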